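(* Let $X$ be a sequentially complete locally convex space and let $A\in L(X)$. Let $R>0$ be such that for every $p\in\mathrm{cs}(X)$ there exist $q\in\mathrm{cs}(X)$ and a sequence $(\mu_n)_{n\in\mathbb{N}_0}$ of numbers $\mu_n>0$ with $$p(A^nx)\leqslant \mu_n\,q(x)\ \text{ for all } n\in\mathbb{N}_0 \text{ and all } x\in X,\qquad\text{and}\qquad \sum_{n=0}^{\infty}\frac{\mu_n}{n!}R^n<\infty .$$ Then $A$ is the generator of a $C_0$-semigroup $(T(t))_{t\geqslant 0}$ on $X$. Moreover, the map $T(\cdot)\colon[0,R]\to L_b(X)$ is uniformly continuous (that is, continuous as a map from $[0,R]$ into $L_b(X)$), and for every $t\in[0,R]$ it is given by $$T(t)=\sum_{n=0}^{\infty}\frac{t^n}{n!}A^n,$$ where the series converges in $L_b(X)$.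
   Context: Locally convex spaces are, as usual, Hausdorff. $\mathrm{cs}(X)$ denotes the system of all continuous seminorms on $X$. $L(X)$ denotes the space of all linear and continuous maps from $X$ into itself. $L_b(X)$ denotes $L(X)$ endowed with the topology of uniform convergence on the bounded subsets of $X$, given by the seminorms $q_B(S)=\sup_{x\in B}q(Sx)$ for $S\in L(X)$, where $B\subseteq X$ is bounded and $q\in\mathrm{cs}(X)$. A $C_0$-semigroup $(T(t))_{t\geqslant0}$ on $X$ is a family of maps $T(t)\in L(X)$ such that $T(0)=\mathrm{id}_X$, $T(t+s)=T(t)T(s)$ for $t,s\geqslant 0$, and $\lim_{t\to t_0}T(t)x=T(t_0)x$ for all $x\in X$ and $t_0\geqslant 0$. Its generator is the operator $A\colon D(A)\to X$ given by $Ax=\lim_{t\searrow 0}\frac{T(t)x-x}{t}$ on $D(A)=\{x\in X : \lim_{t\searrow 0}\frac{T(t)x-x}{t}\text{ exists}\}$. An operator $A\in L(X)$ generates the semigroup if it equals this generator (in particular $D(A)=X$). *)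

(* Defs.v *)
From HB Require Import structures.
From mathcomp Require Import all_boot all_order all_algebra.
From mathcomp Require Import all_classical all_reals topology normedtype sequences.
From mathcomp Require Export complex.

Set Implicit Arguments.
Unset Strict Implicit.
Unset Printing Implicit Defensive.

Import Order.TTheory GRing.Theory Num.Theory.
Import numFieldNormedType.Exports.

Local Open Scope classical_set_scope.
Local Open Scope ring_scope.

(* The scalar field [K : numFieldType] stands for the reals or the complex
   numbers.  Seminorms, times and bounds take their values in [K] itself, as the
   norms of the library do: in [K] both [0 <= x] and [0 < x] force [x] to be
   real, also when [K] is the field of complex numbers. *)

Section LocallyConvex.
Context {K : numFieldType} {X : tvsType K}.

Definition continuous_seminorm (p : X -> K) : Prop :=
  [/\ forall x, 0 <= p x,
      forall x y, p (x + y) <= p x + p y,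
      forall a x, p (a *: x) = `|a| * p x
    & continuous p].

Definition tvs_bounded (B : set X) : Prop :=
  forall U : set X, nbhs 0 U ->
    exists2 s : K, 0 < s & forall t, s < t -> B `<=` [set t *: u | u in U].

(* The uniform structure carried by a [tvsType] induces its topology but need
   not be the translation-invariant one, so Cauchy sequences are defined from
   the neighbourhoods of 0 and not from entourages. *)
Definition cauchy_sequence (u : nat -> X) : Prop :=
  forall U : set X, nbhs 0 U ->
    exists N, forall m n, (N <= m)%N -> (N <= n)%N -> U (u m - u n).

End LocallyConvex.

Definition sequentially_complete {K : numFieldType} (X : tvsType K) : Prop :=
  forall u : nat -> X, cauchy_sequence u -> exists l : X, u @ \oo --> l.

Section ContinuousEndomorphisms.
Context {K : numFieldType} (X : tvsType K).

Definition continuous_linear : {pred X -> X} :=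
  [pred f | `[< linear f /\ continuous f >]].

Record Lb := MkLb { Lb_fun :> X -> X ; _ : Lb_fun \in continuous_linear }.

HB.instance Definition _ := [isSub for Lb_fun].
HB.instance Definition _ := [Choice of Lb by <:].

Lemma continuous_linearP f :
  reflect (linear f /\ continuous f) (f \in continuous_linear).
Proof. exact: asboolP. Qed.

Lemma Lb_linear (S : Lb) : linear S.
Proof. by have /continuous_linearP[] := valP S. Qed.

Lemma Lb_continuous (S : Lb) : continuous S.
Proof. by have /continuous_linearP[] := valP S. Qed.

Fact continuous_linear_submod : submod_closed continuous_linear.
Proof.
split.
  apply/continuous_linearP; split.
    by move=> a x y; rewrite /= scaler0 addr0.
  exact: cst_continuous.
move=> a f g /continuous_linearP[lf cf] /continuous_linearP[lg cg].
apply/continuous_linearP; split.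
  move=> b x y; rewrite !fctE lf lg !scalerDr !scalerA (mulrC a b).
  by rewrite addrACA.
move=> x.
have cZ : (a *: f y) @[y --> x] --> a *: f x.
  have h : ((a : K^o), f y) @[y --> x] --> ((a : K^o), f x).
    apply: (@cvg_pair _ _ _ _ (nbhs (a : K^o)) (nbhs (f x)));
      [exact: cvg_cst|exact: cf].
  have h2 := @scale_continuous K X (a : K^o, f x).
  exact: (cvg_comp _ _ h h2).
have h : (a *: f y, g y) @[y --> x] --> (a *: f x, g x).
  by apply: cvg_pair; [exact: cZ|exact: cg].
exact: (cvg_comp _ _ h (@add_continuous X (a *: f x, g x))).
Qed.

HB.instance Definition _ :=
  GRing.isSubmodClosed.Build K (X -> X) continuous_linear
    continuous_linear_submod.
HB.instance Definition _ := [SubChoice_isSubLmodule of Lb by <:].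

Fact id_continuous_linear : (@id X) \in continuous_linear.
Proof. by apply/continuous_linearP; split=> // x; exact: cvg_id. Qed.

Fact comp_continuous_linear (S T : Lb) : (S \o T) \in continuous_linear.
Proof.
apply/continuous_linearP; split.
  by move=> a x y; rewrite /= (Lb_linear T) (Lb_linear S).
by move=> x; apply: continuous_comp; exact: Lb_continuous.
Qed.

Definition Lb_one : Lb := MkLb id_continuous_linear.
Definition Lb_mul (S T : Lb) : Lb := MkLb (comp_continuous_linear S T).

Fact Lb_mulA : associative Lb_mul.
Proof. by move=> S T V; exact/val_inj. Qed.
Fact Lb_mul1l : left_id Lb_one Lb_mul.
Proof. by move=> S; exact/val_inj. Qed.
Fact Lb_mul1r : right_id Lb_one Lb_mul.
Proof. by move=> S; exact/val_inj. Qed.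
Fact Lb_mulDl : left_distributive Lb_mul +%R.
Proof. by move=> S T V; exact/val_inj. Qed.
Fact Lb_mulDr : right_distributive Lb_mul +%R.
Proof.
move=> S T V; apply/val_inj/funext => x /=.
by have := Lb_linear S 1 (T x) (V x); rewrite !scale1r.
Qed.

(* The product of the ring is composition, so [A ^+ n] is the n-th iterate. *)
HB.instance Definition _ :=
  GRing.Zmodule_isPzRing.Build Lb Lb_mulA Lb_mul1l Lb_mul1r Lb_mulDl Lb_mulDr.

Definition Lb_seminorm (q : X -> K) (B : set X) (S : Lb) : K :=
  supremum 0 [set q (S x) | x in B].

(* The topology generated by the open balls of the seminorms [Lb_seminorm q B],
   with [q] a continuous seminorm and [B] bounded. *)
Definition Lb_ball (i : (X -> K) * set X * Lb * K) : set Lb :=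
  let: (q, B, S0, e) := i in [set S | Lb_seminorm q B (S - S0) < e].

Definition Lb_ball_index : set ((X -> K) * set X * Lb * K) :=
  [set i | let: (q, B, _, e) := i in
           [/\ continuous_seminorm q, tvs_bounded B & 0 < e]].

HB.instance Definition _ := isPointed.Build Lb 0.
HB.instance Definition _ := isSubBaseTopological.Build Lb Lb_ball_index Lb_ball.

End ContinuousEndomorphisms.

Section Semigroups.
Context {K : numFieldType} {X : tvsType K}.

(* Families indexed by t >= 0 are functions on [K]; the values at the other
   elements of [K] are irrelevant. *)
Definition C0_semigroup (T : K -> Lb X) : Prop :=
  [/\ T 0 = 1,
      forall t s : K, 0 <= t -> 0 <= s -> T (t + s) = T t * T s
    & forall (x : X) (t0 : K), 0 <= t0 ->
        T t x @[t --> within [set t : K | 0 <= t] (nbhs t0)] --> T t0 x].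

(* The generator is a partial operator, given by its graph: its domain is the
   set of all [x] such that [generator T x y] for some [y]. *)
Definition generator (T : K -> Lb X) (x y : X) : Prop :=
  t^-1 *: (T t x - x) @[t --> 0^'+] --> y.

Definition generates (A : Lb X) (T : K -> Lb X) : Prop :=
  forall x y, generator T x y <-> y = A x.

End Semigroups.

(* Main.v *)
Require Import Defs.
From HB Require Import structures.
From mathcomp Require Import all_boot all_order all_algebra.
From mathcomp Require Import all_classical all_reals topology normedtype sequences.
From mathcomp Require Import complex.
From mathcomp Require Import convex interval_inference.

Import Order.TTheory GRing.Theory Num.Theory.
Import numFieldNormedType.Exports.
Local Open Scope classical_set_scope.
Local Open Scope ring_scope.

Set Implicit Arguments.
Unset Strict Implicit.
Unset Printing Implicit Defensive.

(** On [0, r] the exponential series of A converges because its terms are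
    dominated: the hypothesis says that p(A^n x) r^n / n! <= a n q(x) with a
    summable sequence a, for every continuous seminorm p.  Sequential completeness
    gives the sum E(t) x for every x, and since the domination is uniform in x up
    to the seminorm q, the partial sums converge to E(t) uniformly on bounded sets
    ([exp_exists], [exp_series_unif], [cvg_Lb]).

    The radius r is finite, so the series defines the semigroup on [0, r] only.
    There E satisfies E(u + v) = E(u) E(v) for u + v <= r: the product of two
    partial sums differs from a partial sum of the product by a polynomial in A
    with small dominated coefficients ([exp_sumD], [expD]).  Consequently
    E(t) = E(t / m)^m on [0, r], and T(t) = E(t / m)^m is independent of m for
    every t >= 0 with t / m <= r.  This T is the semigroup
    ([semigroup_extension_exists], [semigroupD]).

    Termwise differentiation is not available at t = r, where the differentiated
    series may diverge.  Instead, the remainders of E after n terms are of order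
    t^n at t = 0 ([exp_remainder]).  For n = 1 the semigroup law spreads this to a
    Lipschitz estimate on every bounded interval ([semigroup_lipschitz]), which
    yields both strong continuity and norm continuity on [0, r].  For n = 2 it
    shows that the generator is A ([semigroup_generates]).

    All of this is about continuous seminorms, whereas the topology of X is given
    by a basis of convex sets.  The link is the gauge of a balanced convex
    neighborhood of 0 ([nbhs0_seminorm], [cvg_seminormP]). *)

(** * Completeness of the scalars *)

(** The form in which completeness of the reals is used, common to both scalar
    fields: bounded sets of nonnegative scalars have suprema.  For the
    complex numbers it is about the partial order in which comparable elements
    have the same imaginary part. *)
Definition nneg_complete (K : numFieldType) : Prop :=
  forall E : set K, E !=set0 -> (forall x, E x -> 0 <= x) ->
    has_ubound E -> supremums E !=set0.

Lemma nneg_complete_real (R : realType) : nneg_complete R.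
Proof.
move=> E E0 _ ubE; exists (sup E); split; first exact: sup_upper_bound.
by move=> y Ey; exact: ge_sup.
Qed.

Lemma nneg_complete_complex (R : realType) : nneg_complete R[i].
Proof.
move=> E [x0 Ex0] posE [b ubE].
have reE x : E x -> x = (complex.Re x)%:C%C.
  by case: x => a c /posE; rewrite lecE /= => /andP[/eqP -> _].
set F := [set complex.Re x | x in E].
have supF : has_sup F.
  split; first by exists (complex.Re x0), x0.
  exists (complex.Re b) => _ [x Ex <-].
  by have := ubE _ Ex; rewrite lecE => /andP[].
exists (sup F)%:C%C; split=> [x Ex|y uby].
  rewrite (reE _ Ex) lecR; apply: sup_upper_bound => //; by exists x.
have Imy : complex.Im y = 0.
  have := uby _ Ex0; rewrite (reE _ Ex0) lecE /= => /andP[/eqP -> _] //.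
rewrite lecE /= Imy eqxx /=; apply: ge_sup; first by case: supF.
by move=> _ [x Ex <-]; have := uby _ Ex; rewrite lecE => /andP[].
Qed.

Lemma nneg_complete_archi (K : numFieldType) (x : K) :
  nneg_complete K -> 0 <= x -> exists n : nat, x < n%:R.
Proof.
move=> cK x0; apply: contrapT => nx.
have ubx n : n%:R <= x.
  rewrite real_leNgt ?realn ?ger0_real //; apply/negP => xn.
  by apply: nx; exists n.
pose E : set K := range (fun n : nat => n%:R).
(* If no natural exceeded x, their supremum s would satisfy s <= s - 1. *)
have [|_ [n _ <-]||s [ubs lbs]] := cK E; first by exists 0%:R, 0%N.
- exact: ler0n.
- by exists x => _ [n _ <-].
have : s <= s - 1.
  apply: lbs => _ [n _ <-]; rewrite lerBrDr natr1.
  by apply: ubs; exists n.+1.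
by rewrite lerBrDr gerDl ler10.
Qed.

Section SupremumNneg.
Context {K : numFieldType} (cK : nneg_complete K).
Variables (E : set K) (posE : forall x, E x -> 0 <= x).

Lemma supremum_supremums : E !=set0 -> has_ubound E -> supremums E (supremum 0 E).
Proof.
move=> E0 ubE; rewrite /supremum ifF; last first.
  by apply/negbTE/set0P.
by have [s sE] := cK E0 posE ubE; exact: (xgetPex 0 (ex_intro _ s sE)).
Qed.

Lemma le_supremum x : E x -> has_ubound E -> x <= supremum 0 E.
Proof.
by move=> Ex ubE; have [+ _] := supremum_supremums (ex_intro _ x Ex) ubE; apply.
Qed.

Lemma supremum_le b : 0 <= b -> ubound E b -> supremum 0 E <= b.
Proof.
move=> b0 Eb; have [->|/set0P E0] := eqVneq E set0; first by rewrite supremum0.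
by have [_] := supremum_supremums E0 (ex_intro _ b Eb); apply.
Qed.

End SupremumNneg.

(** * Operators and continuous seminorms *)

Section ApplyOperator.
Context {K : numFieldType} {X : tvsType K}.
Implicit Types (S : Lb X) (x y : X).

Lemma Lb_subE S S' x : (S - S') x = S x - S' x.
Proof. by []. Qed.

Lemma Lb_sumE (I : Type) (s : seq I) (P : pred I) (F : I -> Lb X) x :
  (\sum_(i <- s | P i) F i) x = \sum_(i <- s | P i) F i x.
Proof. by elim/big_rec2: _ => // i y z _ <-. Qed.

Lemma Lb_applyZ (S : Lb X) (a : K) x : S (a *: x) = a *: S x.
Proof.
have lS := Lb_linear S.
have S0 : S 0 = 0 by have := lS (-1) 0 0; rewrite scaler0 addr0 scaleN1r addNr.
by have := lS a x 0; rewrite S0 !addr0.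
Qed.

Lemma Lb_applyD (S : Lb X) x y : S (x + y) = S x + S y.
Proof. by have := Lb_linear S 1 x y; rewrite !scale1r. Qed.

Lemma Lb_applyB (S : Lb X) x y : S (x - y) = S x - S y.
Proof. by rewrite Lb_applyD -scaleN1r Lb_applyZ scaleN1r. Qed.

Lemma Lb_apply_sum (S : Lb X) (I : Type) (s : seq I) (P : pred I) (F : I -> X) :
  S (\sum_(i <- s | P i) F i) = \sum_(i <- s | P i) S (F i).
Proof.
elim/big_rec2: _ => [|i y z _ <-]; last exact: Lb_applyD.
by rewrite -[X in S X](scale0r 0) Lb_applyZ scale0r.
Qed.

End ApplyOperator.

Section Seminorms.
Context {K : numFieldType} {X : tvsType K}.
Implicit Types (p q : X -> K) (x y : X).

Lemma affine_continuous (a : K) (c : X) : continuous (fun y => a *: (y + c)).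
Proof.
move=> x.
have h : (y, c) @[y --> x] --> (x, c).
  by apply: cvg_pair; [exact: cvg_id|exact: cvg_cst].
have h1 := cvg_comp _ _ h (@add_continuous X (x, c)).
have h2 : ((a : K^o), y + c) @[y --> x] --> ((a : K^o), x + c).
  apply: (@cvg_pair _ _ _ _ (nbhs (a : K^o)) (nbhs (x + c))); last exact: h1.
  exact: cvg_cst.
exact: (cvg_comp _ _ h2 (@scale_continuous K X (a : K^o, x + c))).
Qed.

Lemma nbhs_translate (U : set X) x : nbhs x U -> nbhs 0 [set u | U (u + x)].
Proof.
move=> Ux; have := @affine_continuous 1 x 0; rewrite /continuous_at scale1r add0r => c.
have h : \forall y \near 0, U (1 *: (y + x)) by exact: c.
by apply: filterS h => y /=; rewrite scale1r.
Qed.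

Section OneSeminorm.
Variables (p : X -> K) (hp : continuous_seminorm p).

Lemma csn_ge0 x : 0 <= p x. Proof. by case: hp. Qed.
Lemma csnD x y : p (x + y) <= p x + p y. Proof. by case: hp. Qed.
Lemma csnZ a x : p (a *: x) = `|a| * p x. Proof. by case: hp. Qed.
Lemma csn_continuous : continuous p. Proof. by case: hp. Qed.
Lemma csn0 : p 0 = 0.
Proof. by rewrite -(scale0r 0) csnZ normr0 mul0r. Qed.
Lemma csnN x : p (- x) = p x.
Proof. by rewrite -scaleN1r csnZ normrN1 mul1r. Qed.
Lemma csn_triangle y x z : p (x - z) <= p (x - y) + p (y - z).
Proof. by rewrite -[x - z](subrKA y) csnD. Qed.

Lemma csn_sum (I : Type) (s : seq I) (P : pred I) (F : I -> X) :
  p (\sum_(i <- s | P i) F i) <= \sum_(i <- s | P i) p (F i).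
Proof.
elim/big_ind2: _ => [|x a y b xa yb|//]; first by rewrite csn0.
exact: le_trans (csnD _ _) (lerD xa yb).
Qed.

Lemma csn_near x e : 0 < e -> \forall y \near x, p (y - x) < e.
Proof.
move=> e0; have c : p (y - x) @[y --> x] --> (0 : K).
  have := @affine_continuous 1 (- x) x.
  rewrite /continuous_at subrr scaler0 => h.
  have := cvg_comp _ _ h (@csn_continuous 0); rewrite csn0.
  by rewrite (_ : _ \o _ = fun y => p (y - x))//; apply/funext => y /=; rewrite scale1r.
have {}c : \forall y \near x, `|0 - p (y - x)| < e by exact: cvgr_dist_lt c _ e0.
by apply: filterS c => y; rewrite sub0r normrN ger0_norm ?csn_ge0.
Qed.

End OneSeminorm.

(** A seminorm bounded by 1 near 0 is bounded by e near 0 for every e > 0, by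
    homogeneity, and the reverse triangle inequality moves this to any point. *)
Lemma continuous_seminorm_near0 p :
    (forall x, 0 <= p x) -> (forall x y, p (x + y) <= p x + p y) ->
    (forall a x, p (a *: x) = `|a| * p x) ->
    (\forall x \near 0, p x <= 1) ->
  continuous_seminorm p.
Proof.
move=> p0 pD pZ p1; split=> // x.
have pN y : p (- y) = p y by rewrite -scaleN1r pZ normrN1 mul1r.
apply/cvgrPdist_le => e e0.
have h : e^-1 *: (y - x) @[y --> x] --> (0 : X).
  by have := @affine_continuous e^-1 (- x) x; rewrite /continuous_at subrr scaler0.
have {}h : \forall y \near x, p (e^-1 *: (y - x)) <= 1 by exact: h _ p1.
apply: filterS h => y.
rewrite pZ gtr0_norm ?invr_gt0// mulrC ler_pdivrMr// mul1r => ple.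
have pdist u v : p u - p v <= p (v - u).
  by rewrite lerBlDr -[p (v - u)]pN opprB -{1}(subrK v u) pD.
rewrite real_ler_norml ?realB ?ger0_real// lerNl opprB.
by rewrite !(le_trans (pdist _ _))// -[p _]pN opprB.
Qed.

Lemma csn_scale p (c : K) : 0 <= c -> continuous_seminorm p ->
  continuous_seminorm (fun x => c * p x).
Proof.
move=> c0 hp; split=> [x|x y|a x|].
- by rewrite mulr_ge0 ?(csn_ge0 hp).
- by rewrite -mulrDr ler_wpM2l ?(csnD hp).
- by rewrite (csnZ hp) mulrCA.
- by move=> x; apply: cvgM; [exact: cvg_cst|exact: csn_continuous].
Qed.

Lemma csn_comp p (S : Lb X) : continuous_seminorm p ->
  continuous_seminorm (fun x => p (S x)).
Proof.
move=> hp; split=> [x|x y|a x|x].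
- exact: csn_ge0.
- by rewrite Lb_applyD; exact: csnD.
- by rewrite Lb_applyZ; exact: csnZ.
- by apply: continuous_comp; [exact: Lb_continuous|exact: csn_continuous].
Qed.

End Seminorms.

(** * The seminorms determine the topology *)

Section Gauge.
Context {K : numFieldType} (cK : nneg_complete K) {X : tvsType K}.

Section OneGauge.
Variables (V : set X) (nV : nbhs 0 V).
Hypothesis cV : forall x y (l : K), 0 <= l <= 1 -> V x -> V y ->
  V (l *: x + (1 - l) *: y).
Hypothesis bV : forall (a : K) x, `|a| <= 1 -> V x -> V (a *: x).

(** The gauge of V is the infimum of the t > 0 such that x lies in t V.  It is
    obtained as the supremum of the nonnegative lower bounds of these t, because
    completeness is available for suprema. *)
Definition gauge_lower (x : X) : set K :=
  [set s | 0 <= s /\ forall t, 0 < t -> V (t^-1 *: x) -> s <= t].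

Definition gauge (x : X) : K := supremum 0 (gauge_lower x).

Lemma nbhs0_absorbing x : exists2 t, 0 < t & V (t^-1 *: x).
Proof.
have := @scale_continuous K X ((0 : K^o), x); rewrite /continuous_at /= scale0r.
move=> /(_ _ nV)[[D W] [/= /nbhs_ballP[d /= d0 dD] nW] DWV].
exists (d / 2)^-1; first by rewrite invr_gt0 divr_gt0.
rewrite invrK; apply: (DWV (_, _)); split; last exact: nbhs_singleton.
apply: dD; rewrite /ball /= sub0r normrN gtr0_norm ?divr_gt0//.
by rewrite ltr_pdivrMr// ltr_pMr// ltr1n.
Qed.

Lemma gauge_lower_ub x : has_ubound (gauge_lower x).
Proof. by have [t t0 Vt] := nbhs0_absorbing x; exists t => s [_]; apply. Qed.

Lemma gauge_lower0 x : gauge_lower x 0.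
Proof. by split=> // t /ltW. Qed.

Let gauge_pos x s : gauge_lower x s -> 0 <= s. Proof. by case. Qed.

Lemma gauge_ge0 x : 0 <= gauge x.
Proof.
exact: le_supremum (@gauge_pos x) _ (gauge_lower0 x) (gauge_lower_ub x).
Qed.

Lemma gauge_le x t : 0 < t -> V (t^-1 *: x) -> gauge x <= t.
Proof.
by move=> t0 Vt; apply: (supremum_le cK (@gauge_pos x) (ltW t0)) => s [_]; apply.
Qed.

(** V is balanced, so the t > 0 with x in t V form an upward closed set; hence t
    is a member as soon as it exceeds their infimum. *)
Lemma gauge_lt x t : gauge x < t -> V (t^-1 *: x).
Proof.
move=> gt; apply: contrapT => nV'.
have t0 : 0 < t by exact: le_lt_trans (gauge_ge0 x) gt.
suff: t <= gauge x by move=> /(lt_le_trans gt); rewrite ltxx.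
apply: le_supremum (@gauge_pos x) _ _ (gauge_lower_ub x) => //.
split=> [|u u0 Vu]; first exact: ltW.
rewrite real_leNgt ?gtr0_real//; apply/negP => ut; apply: nV'.
have -> : t^-1 *: x = (u / t) *: (u^-1 *: x).
  by rewrite scalerA mulrAC divff ?gt_eqF// mul1r.
by apply: bV => //; rewrite gtr0_norm ?divr_gt0// ler_pdivrMr// mul1r ltW.
Qed.

Lemma gaugeD x y : gauge (x + y) <= gauge x + gauge y.
Proof.
apply/ler_addgt0Pr => e e0; have e20 : 0 < e / 2 by rewrite divr_gt0.
have gx := @gauge_lt x (gauge x + e / 2); rewrite ltrDl e20 in gx.
have gy := @gauge_lt y (gauge y + e / 2); rewrite ltrDl e20 in gy.
move: (gx isT) (gy isT); set s := gauge x + _; set t := gauge y + _ => Vx Vy.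
have s0 : 0 < s by rewrite ltr_wpDl ?gauge_ge0.
have t0 : 0 < t by rewrite ltr_wpDl ?gauge_ge0.
have st0 : 0 < s + t by rewrite addr_gt0.
have -> : gauge x + gauge y + e = s + t by rewrite addrACA -splitr.
apply: gauge_le => //.
have := @cV _ _ (s / (s + t)) _ Vx Vy.
rewrite !scalerA mulrAC divff ?gt_eqF// mul1r.
have -> : 1 - s / (s + t) = t / (s + t).
  by rewrite -{1}(@divff _ (s + t)) ?gt_eqF// -mulrBl addrAC subrr add0r.
rewrite mulrAC divff ?gt_eqF// mul1r -scalerDr; apply.
by rewrite divr_ge0 ?(ltW s0) ?(ltW st0)//= ler_pdivrMr// mul1r lerDl ltW.
Qed.

Let gaugeZ_le a x : gauge (a *: x) <= `|a| * gauge x.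
Proof.
have [->|a0] := eqVneq a 0.
  rewrite scale0r normr0 mul0r; apply/ler_addgt0Pr => e e0; rewrite add0r.
  by apply: gauge_le => //; rewrite scaler0; exact: nbhs_singleton.
have na0 : 0 < `|a| by rewrite normr_gt0.
apply/ler_addgt0Pr => e e0; have e' : 0 < e / `|a| by rewrite divr_gt0.
have gx := @gauge_lt x (gauge x + e / `|a|); rewrite ltrDl e' in gx.
have -> : `|a| * gauge x + e = `|a| * (gauge x + e / `|a|).
  by rewrite mulrDr mulrCA divff ?gt_eqF// mulr1.
move: (gx isT); set s := gauge x + _ => Vx.
have s0 : 0 < s by rewrite ltr_wpDl ?gauge_ge0.
apply: gauge_le; first by rewrite mulr_gt0.
have -> : (`|a| * s)^-1 *: (a *: x) = (a / `|a|) *: (s^-1 *: x).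
  by rewrite !scalerA invfM; congr (_ *: _); rewrite [a / _]mulrC mulrAC.
by apply: bV => //; rewrite normrM normfV normr_id divff ?gt_eqF.
Qed.

Lemma gaugeZ a x : gauge (a *: x) = `|a| * gauge x.
Proof.
apply/le_anti; rewrite gaugeZ_le /=; have [->|a0] := eqVneq a 0.
  by rewrite normr0 mul0r gauge_ge0.
rewrite -ler_pdivlMl ?normr_gt0//.
by have := gaugeZ_le a^-1 (a *: x); rewrite scalerA mulVf// scale1r normfV.
Qed.

Lemma gauge_continuous_seminorm : continuous_seminorm gauge.
Proof.
apply: continuous_seminorm_near0; [exact: gauge_ge0|exact: gaugeD|exact: gaugeZ|].
by apply: filterS nV => x Vx; apply: gauge_le; rewrite // invr1 scale1r.
Qed.

End OneGauge.

(** A convex neighborhood b of 0 need not be balanced.  The points x all of whose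
    multiples a x with |a| <= 1 lie in b form a balanced convex set inside b; it
    is a neighborhood of 0 by joint continuity of the scaling.  Its gauge is the
    seminorm. *)
Lemma nbhs0_seminorm (U : set X) : nbhs 0 U ->
  exists2 p, continuous_seminorm p & forall x, p x < 1 -> U x.
Proof.
move=> nU; have [B cB [Bo Bb]] := @locally_convex K X.
have [b [Bb' b0] bU] := Bb _ _ nU.
pose V : set X := [set x | forall a : K, `|a| <= 1 -> b (a *: x)].
have nV : nbhs 0 V.
  have nb : nbhs 0 b by apply: open_nbhs_nbhs; split=> //; exact: Bo.
  have := @scale_continuous K X ((0 : K^o), 0); rewrite /continuous_at /= scaler0.
  move=> /(_ _ nb)[[D W] [/= /nbhs_ballP[d /= d0 dD] nW] DWb].
  have d20 : 0 < d / 2 by rewrite divr_gt0.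
  have := @nbhs0Z K X W (d / 2) (lt0r_neq0 d20) nW.
  apply: filterS => _ [w Ww <-] a a1; rewrite scalerA.
  apply: (DWb (_, _)); split=> //=; apply: dD.
  rewrite /ball /= sub0r normrN normrM [`|d / 2|]gtr0_norm//.
  apply: (@le_lt_trans _ _ (d / 2)); first by rewrite ler_piMl// ltW.
  by rewrite ltr_pdivrMr// ltr_pMr// ltr1n.
have convV x y (l : K) : 0 <= l <= 1 -> V x -> V y -> V (l *: x + (1 - l) *: y).
  move=> /andP[l0 l1] Vx Vy a a1; rewrite scalerDr !scalerA.
  have := cB b (mem_set Bb') _ _ (Itv01 l0 l1) (mem_set (Vx a a1)) (mem_set (Vy a a1)).
  rewrite inE /conv /= !scalerA /=.
  by rewrite [a * l]mulrC [a * (1 - l)]mulrC.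
have balV (a : K) x : `|a| <= 1 -> V x -> V (a *: x).
  move=> a1 Vx c c1; rewrite scalerA; apply: Vx.
  by rewrite normrM mulr_ile1.
exists (gauge V); first exact: gauge_continuous_seminorm.
move=> x /(gauge_lt nV balV) /(_ 1); rewrite normr1 invr1 !scale1r => bx.
by apply/bU/bx.
Qed.

Lemma cvg_seminormP {T : Type} (F : set_system T) {FF : Filter F} (f : T -> X) l :
  f @ F --> l <-> forall p, continuous_seminorm p -> forall e, 0 < e ->
    \forall t \near F, p (f t - l) < e.
Proof.
split=> [fl p hp e e0|h U nU].
  exact: (fl _ (@csn_near _ _ _ hp l e e0)).
have [p hp pU] := nbhs0_seminorm (nbhs_translate nU).
have := h p hp 1 ltr01; apply: filterS => t /pU.
by rewrite /= subrK.
Qed.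

End Gauge.

(** * Convergence in the space of operators *)

Section BoundedConvergence.
Context {K : numFieldType} (cK : nneg_complete K) {X : tvsType K}.
Implicit Types (p q : X -> K) (S : Lb X).

Lemma csn_bounded q (B : set X) : continuous_seminorm q -> tvs_bounded B ->
  exists2 b, 0 < b & forall x, B x -> q x <= b.
Proof.
move=> hq bB; have U1 : nbhs 0 [set x | q x < 1].
  by have := csn_near hq 0 ltr01; apply: filterS => x; rewrite subr0.
have [s s0 /(_ (s + 1))] := bB _ U1; rewrite ltrDl ltr01 => /(_ isT) BU.
exists (s + 1) => [|x /BU[u /= qu <-]]; first exact: addr_gt0.
by rewrite (csnZ hq) gtr0_norm ?addr_gt0// ler_piMr ?ltW ?addr_gt0.
Qed.

(** The topology is generated by balls with arbitrary centres S0, so a ball around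
    S0 that contains S has to be reached by the triangle inequality.  A bounded
    set B turns the estimate e q(x), which is uniform up to the seminorm q, into
    an estimate uniform on B.  All norm limits below are proved in this form. *)
Lemma cvg_Lb {T : Type} (F : set_system T) {FF : Filter F} (f : T -> Lb X) S :
    (forall p, continuous_seminorm p -> exists2 q, continuous_seminorm q &
      forall e, 0 < e -> \forall t \near F, forall x, p (f t x - S x) <= e * q x) ->
  f @ F --> S.
Proof.
move=> h U [_ [[D' D'sub <-] [I D'I IS] sU]].
have [D Dsub DI] := D'sub _ D'I.
suff FI : F (f @^-1` I) by apply: filterS FI => t It; apply: sU; exists I.
rewrite -DI preimage_bigcap.
apply: filter_bigI => -[[[q B] S0] e] iD.
have /Dsub := iD; rewrite inE => -[hq bB e0].
have SI : Lb_seminorm q B (S - S0) < e.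
  by move: IS; rewrite -DI => /(_ _ iD).
have [q' hq' hF] := h q hq.
have [b b0 Bb] := csn_bounded hq' bB.
have [bS bS0 BbS] := csn_bounded (csn_comp (S - S0) hq) bB.
set s := Lb_seminorm q B (S - S0) in SI.
have posim (S1 : Lb X) y : [set q (S1 x) | x in B] y -> 0 <= y.
  by move=> [x _ <-]; exact: csn_ge0.
have les x : B x -> q ((S - S0) x) <= s.
  move=> Bx; apply: (le_supremum cK (@posim _)); first by exists x.
  by exists bS => _ [z Bz <-]; exact: BbS.
have s0 : 0 <= s.
  rewrite /s /Lb_seminorm; have [->|/set0P[x Bx]] := eqVneq B set0.
    by rewrite image_set0 supremum0.
  exact: le_trans (csn_ge0 hq _) (les x Bx).
have d0 : 0 < (e - s) / 2 / b by rewrite !divr_gt0// subr_gt0.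
have := hF _ d0; apply: filterS => t ht.
rewrite /= /Lb_ball /=.
apply: (@le_lt_trans _ _ ((e - s) / 2 + s)); last first.
  by rewrite -ltrBrDr ltr_pdivrMr ?ltr_pMr ?subr_gt0// ltr1n.
apply: (supremum_le cK (@posim _)).
  by rewrite addr_ge0// divr_ge0// subr_ge0 ltW.
move=> _ [x Bx <-]; rewrite Lb_subE.
apply: le_trans (csn_triangle hq (S x) _ _) _.
apply: lerD; last exact: les.
apply: le_trans (ht x) _; rewrite mulrAC ler_pdivrMr// ler_wpM2l ?Bb//.
by rewrite divr_ge0 ?subr_ge0 ?ltW.
Qed.

Lemma csn_separates (hausX : hausdorff_space X) (x y : X) :
  (forall p, continuous_seminorm p -> p (x - y) <= 0) -> x = y.
Proof.
move=> h; have c : (fun _ : nat => x) @ \oo --> y.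
  apply/(cvg_seminormP cK) => p hp e e0; apply: nearW => _.
  exact: le_lt_trans (h p hp) e0.
exact: (cvg_unique hausX (@cvg_cst _ x _ \oo _) c).
Qed.

Lemma csn_limit_le p (u : nat -> X) (l y : X) (c : K) (n : nat) :
    continuous_seminorm p -> u @ \oo --> l ->
    (forall m, (n <= m)%N -> p (u m - y) <= c) ->
  p (l - y) <= c.
Proof.
move=> hp /(cvg_seminormP cK) ul hu; apply/ler_addgt0Pr => e e0.
have [N _ hN] := ul p hp e e0.
have := hN (maxn N n) (leq_maxl _ _) => /= h1.
apply: le_trans (csn_triangle hp (u (maxn N n)) _ _) _; rewrite addrC lerD//.
  by apply: hu; exact: leq_maxr.
by rewrite -(csnN hp) opprB ltW.
Qed.

End BoundedConvergence.

(** * The exponential series on [0, r] *)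

Section ExpSeries.
Context {K : numFieldType} (cK : nneg_complete K) {X : tvsType K}.
Hypotheses (hausX : hausdorff_space X) (scX : sequentially_complete X).
Variables (A : Lb X) (r : K) (r_gt0 : 0 < r).

Definition exp_sum (t : K) (n : nat) : Lb X :=
  series (fun k => (t ^+ k / k`!%:R) *: A ^+ k) n.

Lemma exp_sumE t n x :
  exp_sum t n x = \sum_(0 <= k < n) (t ^+ k / k`!%:R) *: (A ^+ k) x.
Proof. by rewrite /exp_sum /series /= Lb_sumE. Qed.

(** The weights are absorbed into a n = mu n r^n / n!, whose series converges. *)
Definition exp_majorant (p q : X -> K) (a : nat -> K) : Prop :=
  [/\ forall n, 0 <= a n,
      forall n x, r ^+ n / n`!%:R * p ((A ^+ n) x) <= a n * q x
    & cvgn (series a)].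

Lemma majorant_sum_bound p q a : exp_majorant p q a ->
  exists2 C, 0 <= C & forall n m, \sum_(n <= k < m) a k <= C.
Proof.
move=> [a0 _ /cvg_ex[l /cvgrPdist_lt/(_ 1 ltr01)[N _ hN]]].
exists (`|l| + 1) => [|n m]; first by rewrite addr_ge0.
have mono i j : (i <= j)%N -> \sum_(0 <= k < i) a k <= \sum_(0 <= k < j) a k.
  move=> ij; rewrite (big_cat_nat_idem _ (leq0n i) ij) ?lerDl ?sumr_ge0//.
  exact: addr0.
(* A partial sum within distance 1 of the limit l bounds all earlier ones. *)
apply: le_trans (_ : \sum_(0 <= k < maxn N (maxn n m)) a k <= _).
  have [mn|nm] := leqP m n; first by rewrite big_geq// sumr_ge0.
  apply: le_trans (mono m _ _); last by rewrite !leq_max leqnn !orbT.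
  by rewrite (big_cat_nat_idem _ (leq0n n) (ltnW nm)) ?lerDr ?sumr_ge0//; exact: addr0.
have := hN _ (leq_maxl N (maxn n m)); rewrite /= /series /= => h.
rewrite -[X in X <= _]ger0_norm ?sumr_ge0// -[X in `|X|](subKr l).
by rewrite (le_trans (ler_normB _ _))// lerD2l ltW.
Qed.

Lemma majorant_tail p q a : exp_majorant p q a ->
  forall e, 0 < e -> exists N, forall n m, (N <= n)%N -> \sum_(n <= k < m) a k <= e.
Proof.
move=> [a0 _ /cvg_ex[l /cvgrPdist_lt hl]] e e0.
have [|N _ hN] := hl (e / 2); first by rewrite divr_gt0.
exists N => n m Nn; have [mn|/ltnW nm] := leqP m n.
  by rewrite big_geq// ltW.
have -> : \sum_(n <= k < m) a k = series a m - series a n.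
  by rewrite sub_series_geq.
rewrite -[X in X <= _]ger0_norm; last by rewrite sub_series_geq// sumr_ge0.
rewrite -[_ - _](subrKA l) (le_trans (ler_normD _ _))// [e]splitr lerD//.
  by rewrite distrC ltW// hN//= (leq_trans Nn).
by rewrite ltW// hN.
Qed.

Lemma majorant_le p q a (hp : continuous_seminorm p) (hq : continuous_seminorm q)
    (c : nat -> K) s n m x : exp_majorant p q a -> 0 <= s ->
    (forall k, (n <= k < m)%N -> `|c k| <= s * (r ^+ k / k`!%:R)) ->
  p (\sum_(n <= k < m) c k *: (A ^+ k) x) <= s * (\sum_(n <= k < m) a k) * q x.
Proof.
move=> [a0 pa _] s0 hc; apply: le_trans (csn_sum hp _ _ _) _.
rewrite mulr_sumr mulr_suml; apply: ler_sum_nat => k nkm.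
rewrite (csnZ hp) -mulrA; apply: le_trans (ler_wpM2r (csn_ge0 hp _) (hc k nkm)) _.
by rewrite -mulrA ler_wpM2l.
Qed.

(** The gain (t / r)^n over the majorizing series makes the remainder after n
    terms of order t^n at t = 0: n = 1 yields Lipschitz continuity, and n = 2
    identifies the generator. *)
Lemma pow_ratio_le (t : K) (n k : nat) : 0 <= t <= r -> (n <= k)%N ->
  `|t ^+ k / k`!%:R| <= (t / r) ^+ n * (r ^+ k / k`!%:R).
Proof.
move=> /andP[t0 tr] nk; rewrite ger0_norm ?divr_ge0 ?exprn_ge0//.
rewrite mulrA ler_wpM2r ?invr_ge0//.
rewrite -(subnKC nk) !exprD mulrA -exprMn divfK ?gt_eqF//.
by rewrite ler_wpM2l ?exprn_ge0// lerXn2r ?nnegrE// ltW.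
Qed.

Lemma exp_sum_diff p q a (hp : continuous_seminorm p) (hq : continuous_seminorm q)
    t n m x : exp_majorant p q a -> 0 <= t <= r -> (n <= m)%N ->
  p (exp_sum t m x - exp_sum t n x)
    <= (t / r) ^+ n * (\sum_(n <= k < m) a k) * q x.
Proof.
move=> hpq tr nm; rewrite !exp_sumE.
rewrite (big_cat_nat_idem _ (leq0n n) nm) /=; last exact: addr0.
rewrite [X in X - _]addrC addrK.
apply: (majorant_le hp hq) => //.
  by case/andP: tr => t0 _; rewrite exprn_ge0// divr_ge0// ltW.
by move=> k /andP[nk _]; exact: pow_ratio_le.
Qed.

Definition exp_majorized : Prop := forall p, continuous_seminorm p ->
  exists q a, continuous_seminorm q /\ exp_majorant p q a.

Hypothesis hA : exp_majorized.

Lemma exp_sum_bound p : continuous_seminorm p -> exists2 q, continuous_seminorm q &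
  forall t n x, 0 <= t <= r -> p (exp_sum t n x) <= q x.
Proof.
move=> hp; have [q [a [hq hpq]]] := hA hp.
have [C C0 hC] := majorant_sum_bound hpq.
exists (fun x => C * q x); first exact: csn_scale.
move=> t n x tr; have := exp_sum_diff hp hq x hpq tr (leq0n n).
rewrite (_ : exp_sum t 0 x = 0); last by rewrite exp_sumE big_geq.
rewrite subr0 expr0 mul1r => /le_trans; apply.
by rewrite ler_wpM2r ?hC ?(csn_ge0 hq).
Qed.

(** Local convexity and the tail estimates make the partial sums a Cauchy
    sequence, so sequential completeness provides the sum. *)
Lemma exp_sum_cvg t x : 0 <= t <= r -> exists l : X, (exp_sum t n x) @[n --> \oo] --> l.
Proof.
move=> tr; apply: scX => U nU; have [p hp pU] := nbhs0_seminorm cK nU.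
have [q [a [hq hpq]]] := hA hp.
have e0 : 0 < (q x + 1)^-1 by rewrite invr_gt0 ltr_wpDl// (csn_ge0 hq).
have [N hN] := majorant_tail hpq e0.
have half n m : (N <= n)%N -> (n <= m)%N -> p (exp_sum t m x - exp_sum t n x) < 1.
  move=> Nn nm; apply: le_lt_trans (exp_sum_diff hp hq x hpq tr nm) _.
  apply: (@le_lt_trans _ _ ((q x + 1)^-1 * q x)).
    rewrite ler_wpM2r ?(csn_ge0 hq)// (le_trans _ (hN n m Nn))// ler_piMl//.
      by apply: sumr_ge0 => k _; case: hpq.
    case/andP: tr => t0 tr'.
    by rewrite exprn_ile1 ?divr_ge0 ?ler_pdivrMr ?mul1r// ltW.
  by rewrite mulrC ltr_pdivrMr ?mul1r ?ltrDl// ltr_wpDl// (csn_ge0 hq).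
exists N => m n Nm Nn; apply: pU; have [nm|/ltnW mn] := leqP n m; first exact: half.
by rewrite -(csnN hp) opprB half.
Qed.

Definition exp_limit (E : K -> Lb X) : Prop := forall t, 0 <= t <= r ->
  forall x, (exp_sum t n x) @[n --> \oo] --> E t x.

(** The pointwise sums are linear as limits of linear maps, and continuous
    because the bound on the partial sums is uniform in their length. *)
Lemma exp_exists : exists E : K -> Lb X, exp_limit E.
Proof.
suff h t : exists S : Lb X, 0 <= t <= r ->
    forall x, (exp_sum t n x) @[n --> \oo] --> S x.
  by have [E hE] := choice h; exists E.
have [tr|] := boolP (0 <= t <= r); last by exists 0.
have [f hf] := choice (fun x => exp_sum_cvg x tr).
have linf : linear f.
  move=> a x y; apply: (cvg_unique hausX (hf _)).
  apply/(cvg_seminormP cK) => p hp e e0.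
  have e20 : 0 < e / 2 by rewrite divr_gt0.
  have /(cvg_seminormP cK)/(_ p hp _ e20) hy := hf y.
  have /(cvg_seminormP cK)/(_ _ (csn_scale (normr_ge0 a) hp) _ e20) hx := hf x.
  near=> n; rewrite (Lb_linear (exp_sum t n)) opprD addrACA -scalerBr.
  apply: le_lt_trans (csnD hp _ _) _; rewrite [e]splitr (csnZ hp) ltrD//.
    by near: n; exact: hx.
  by near: n; exact: hy.
have contf : continuous f.
  move=> x; apply/(cvg_seminormP cK) => p hp e e0.
  have [q hq hpq] := exp_sum_bound hp.
  have bf y : p (f y) <= q y.
    rewrite -[f y]subr0; apply: (csn_limit_le cK (n := 0%N) hp (hf y)) => m _.
    by rewrite subr0; exact: hpq.
  have := csn_near hq x e0; apply: filterS => y qy.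
  have -> : f y - f x = f (y - x).
    by rewrite -[f y - f x]addrC -scaleN1r -linf scaleN1r addrC.
  exact: le_lt_trans (bf _) qy.
have fP : f \in @continuous_linear K X by apply/continuous_linearP.
by exists (MkLb fP) => _.
Unshelve. all: by end_near. Qed.

Section ExpFamily.
Variables (E : K -> Lb X).
Hypothesis hE : exp_limit E.

Lemma exp_tail p q a (hp : continuous_seminorm p) (hq : continuous_seminorm q)
    t n C x : exp_majorant p q a -> 0 <= t <= r ->
    (forall m, \sum_(n <= k < m) a k <= C) ->
  p (E t x - exp_sum t n x) <= (t / r) ^+ n * C * q x.
Proof.
move=> hpq tr hC; apply: (csn_limit_le cK (n := n) hp (@hE _ tr x)) => m nm.
apply: le_trans (exp_sum_diff hp hq x hpq tr nm) _.
rewrite ler_wpM2r ?(csn_ge0 hq)// ler_wpM2l//.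
by case/andP: tr => t0 _; rewrite exprn_ge0// divr_ge0// ltW.
Qed.

Lemma exp_remainder p n : continuous_seminorm p -> exists2 q, continuous_seminorm q &
  forall t x, 0 <= t <= r -> p (E t x - exp_sum t n x) <= t ^+ n * q x.
Proof.
move=> hp; have [q [a [hq hpq]]] := hA hp.
have [C C0 hC] := majorant_sum_bound hpq.
have D0 : 0 <= r ^- n * C by rewrite mulr_ge0// invr_ge0 exprn_ge0// ltW.
exists (fun x => r ^- n * C * q x); first exact: csn_scale.
move=> t x tr; apply: le_trans (exp_tail hp hq x hpq tr (hC n)) _.
by rewrite expr_div_n !mulrA.
Qed.

Lemma exp_bound p : continuous_seminorm p -> exists2 q, continuous_seminorm q &
  forall t x, 0 <= t <= r -> p (E t x) <= q x.
Proof.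
move=> hp; have [q hq hpq] := exp_sum_bound hp; exists q => // t x tr.
rewrite -[E t x]subr0; apply: (csn_limit_le cK (n := 0%N) hp (@hE _ tr x)) => m _.
by rewrite subr0; exact: hpq.
Qed.

Lemma exp_remainder1 p : continuous_seminorm p -> exists2 q, continuous_seminorm q &
  forall t x, 0 <= t <= r -> p (E t x - x) <= t * q x.
Proof.
move=> hp; have [q hq h] := exp_remainder 1 hp; exists q => // t x tr.
have := h t x tr; rewrite expr1 (_ : exp_sum t 1 x = x)//.
by rewrite exp_sumE big_nat1 expr0 fact0 divr1 scale1r.
Qed.

Lemma exp_remainder2 p : continuous_seminorm p -> exists2 q, continuous_seminorm q &
  forall t x, 0 <= t <= r -> p (E t x - x - t *: A x) <= t ^+ 2 * q x.
Proof.
move=> hp; have [q hq h] := exp_remainder 2 hp; exists q => // t x tr.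
have := h t x tr; rewrite (_ : exp_sum t 2 x = x + t *: A x) ?opprD ?addrA//.
by rewrite exp_sumE big_nat_recr//= big_nat1 expr0 fact0 !divr1 scale1r.
Qed.

Lemma exp_series_unif p : continuous_seminorm p -> exists2 q, continuous_seminorm q &
  forall e, 0 < e -> \forall n \near \oo, forall t x, 0 <= t <= r ->
    p (E t x - exp_sum t n x) <= e * q x.
Proof.
move=> hp; have [q [a [hq hpq]]] := hA hp; exists q => // e e0.
have [N hN] := majorant_tail hpq e0.
exists N => // n /= Nn t x tr.
apply: le_trans (exp_tail hp hq x hpq tr (fun m => hN n m Nn)) _.
rewrite ler_wpM2r ?(csn_ge0 hq)// ler_piMl ?(ltW e0)//.
case/andP: tr => t0 tr'.
by rewrite exprn_ile1 ?divr_ge0 ?ler_pdivrMr ?mul1r// ltW.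
Qed.

Lemma exp0 : E 0 = 1.
Proof.
apply/val_inj/funext => x /=; apply: (csn_separates cK hausX) => p hp.
have [q hq h] := exp_remainder1 hp.
by have := h 0 x; rewrite lexx ltW// => /(_ isT); rewrite mul0r.
Qed.

End ExpFamily.
End ExpSeries.

(** * The functional equation *)

Section CauchyProduct.
Context {K : numFieldType}.
Implicit Types (u v : K) (N M k : nat).

Definition exp_coef u k : K := u ^+ k / k`!%:R.

(** The coefficient of the k-th power in the product of the truncations at degree
    N of the exponential series with parameters u and v.  The double sum over a
    square with an indicator makes monotonicity in N evident. *)
Definition product_coef u v N k : K :=
  \sum_(i < N) \sum_(j < N) (if (i + j == k)%N then exp_coef u i * exp_coef v j else 0).

Lemma exp_coef_ge0 u k : 0 <= u -> 0 <= exp_coef u k.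
Proof. by move=> u0; rewrite /exp_coef divr_ge0 ?exprn_ge0. Qed.

(** Below degree N truncation has no effect, and the binomial formula applies. *)
Lemma product_coefE u v N k : (k < N)%N -> product_coef u v N k = exp_coef (u + v) k.
Proof.
move=> kN; rewrite /product_coef.
have inner (i : 'I_N) :
    \sum_(j < N) (if (i + j == k)%N then exp_coef u i * exp_coef v j else 0)
    = if (i < k.+1)%N then exp_coef u i * exp_coef v (k - i) else 0.
  rewrite ltnS; have [ik|ki] := leqP i k; last first.
    rewrite big1// => j _; case: eqP => // /esym kij.
    by move: ki; rewrite kij ltnNge leq_addr.
  have kiN : (k - i < N)%N by rewrite (leq_ltn_trans (leq_subr _ _)).
  rewrite (bigD1 (Ordinal kiN))//= subnKC// eqxx big1 ?addr0// => j.
  rewrite -val_eqE /= => jki; case: eqP => // ijk; move: jki.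
  by rewrite -ijk addKn eqxx.
rewrite (eq_bigr _ (fun i _ => inner i)) -big_mkcond/=.
rewrite -(big_ord_widen N (fun i => exp_coef u i * exp_coef v (k - i)) kN).
rewrite /exp_coef addrC exprDn mulr_suml.
apply: eq_bigr => -[i /=]; rewrite ltnS => ik _.
have b0 : 'C(k, i)%:R != 0 :> K by rewrite pnatr_eq0 -lt0n bin_gt0.
rewrite -[k`!](bin_fact ik) -[_ *+ 'C(k, i)]mulr_natr natrM [(_%:R * _%:R)^-1]invfM.
rewrite [RHS]mulrA mulfK//.
by rewrite mulrACA -invfM -natrM [v ^+ _ * _]mulrC.
Qed.

Lemma product_coef_ge0 u v N k : 0 <= u -> 0 <= v -> 0 <= product_coef u v N k.
Proof.
move=> u0 v0; apply: sumr_ge0 => i _; apply: sumr_ge0 => j _.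
by case: ifP => // _; rewrite mulr_ge0 ?exp_coef_ge0.
Qed.

Lemma product_coef_le u v N M k : 0 <= u -> 0 <= v -> (N <= M)%N ->
  product_coef u v N k <= product_coef u v M k.
Proof.
move=> u0 v0 NM; rewrite /product_coef.
pose F i j : K := if (i + j == k)%N then exp_coef u i * exp_coef v j else 0.
have F0 i j : 0 <= F i j.
  by rewrite /F; case: ifP => // _; rewrite mulr_ge0 ?exp_coef_ge0.
have wid (G : nat -> K) : (forall i, 0 <= G i) -> \sum_(i < N) G i <= \sum_(i < M) G i.
  move=> G0; rewrite (big_ord_widen M G NM).
  rewrite [leRHS](bigID (fun i : 'I_M => (i < N)%N))/=.
  by rewrite lerDl sumr_ge0.
apply: le_trans (_ : \sum_(i < N) \sum_(j < M) F i j <= _).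
  by apply: ler_sum => i _; apply: (wid (F i)).
by apply: (wid (fun i => \sum_(j < M) F i j)) => i; rewrite sumr_ge0.
Qed.

End CauchyProduct.

Section ExpSemigroupLaw.
Context {K : numFieldType} (cK : nneg_complete K) {X : tvsType K}.
Hypotheses (hausX : hausdorff_space X) (scX : sequentially_complete X).
Variables (A : Lb X) (r : K) (r_gt0 : 0 < r).
Hypothesis hA : exp_majorized A r.
Variables (E : K -> Lb X).
Hypothesis hE : exp_limit A r E.

Lemma exp_sumM u v N x : exp_sum A u N (exp_sum A v N x) =
  \sum_(0 <= k < N + N) product_coef u v N k *: (A ^+ k) x.
Proof.
rewrite !exp_sumE !big_mkord.
under eq_bigr => i _.
  rewrite Lb_apply_sum scaler_sumr.
  under eq_bigr => j _.
    rewrite Lb_applyZ scalerA -[(A ^+ i) ((A ^+ j) x)]/((A ^+ i * A ^+ j) x) -exprD.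
    have ijN : (i + j < N + N)%N by rewrite -addnS leq_add// ltnW.
    rewrite (_ : _ *: _ = \sum_(k < N + N)
      (if (i + j == k)%N then exp_coef u i * exp_coef v j else 0) *: (A ^+ k) x); last first.
      rewrite (bigD1 (Ordinal ijN))//= eqxx big1 ?addr0// => k.
      by rewrite -val_eqE /= eq_sym => /negbTE ->; rewrite scale0r.
    over.
  rewrite exchange_big /=.
  over.
rewrite exchange_big /=; apply: eq_bigr => k _.
by rewrite /product_coef scaler_suml; apply: eq_bigr => i _; rewrite scaler_suml.
Qed.

(** The difference is a polynomial in A.  Its coefficients vanish below degree N
    and lie between 0 and (u + v)^k / k! <= r^k / k! above, because the missing
    products of coefficients are nonnegative.  So it is bounded by a tail of the
    majorizing series. *)
Lemma exp_sumD p : continuous_seminorm p -> exists2 q, continuous_seminorm q &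
  forall e, 0 < e -> \forall N \near \oo, forall u v x,
    0 <= u -> 0 <= v -> u + v <= r ->
    p (exp_sum A (u + v) (N + N) x - exp_sum A u N (exp_sum A v N x)) <= e * q x.
Proof.
move=> hp; have [q [a [hq hpq]]] := hA hp; exists q => // e e0.
have [N0 hN0] := majorant_tail hpq e0.
exists N0 => // N /= N0N u v x u0 v0 uvr.
rewrite exp_sumM exp_sumE -sumrB.
under eq_bigr do rewrite -scalerBl.
rewrite (big_cat_nat_idem _ (leq0n N) (leq_addr N N)) /=; last exact: addr0.
rewrite big_nat_cond big1 ?add0r => [|k /andP[/andP[_ kN] _]]; last first.
  by rewrite product_coefE// subrr scale0r.
have := @majorant_le _ _ A r p q a hp hq
  (fun k => exp_coef (u + v) k - product_coef u v N k) 1 N (N + N) x hpq ler01.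
rewrite mul1r => h; apply: le_trans (h _) _; last first.
  by rewrite ler_wpM2r ?(csn_ge0 hq)// hN0.
move=> k _; rewrite mul1r.
have le1 : product_coef u v N k <= exp_coef (u + v) k.
  rewrite -(@product_coefE _ u v (maxn N k.+1)); last by rewrite leq_max ltnSn orbT.
  by apply: product_coef_le => //; exact: leq_maxl.
rewrite ger0_norm ?subr_ge0//.
apply: (@le_trans _ _ (exp_coef (u + v) k)).
  by rewrite gerBl product_coef_ge0.
by rewrite /exp_coef ler_wpM2r ?invr_ge0// lerXn2r// nnegrE ?addr_ge0// ltW.
Qed.

(** The products of partial sums converge to the product of the limits: the left
    factors are equicontinuous and the right ones converge pointwise. *)
Lemma expD u v : 0 <= u -> 0 <= v -> u + v <= r -> E (u + v) = E u * E v.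
Proof.
move=> u0 v0 uvr; apply/val_inj/funext => x /=.
have ur : 0 <= u <= r by rewrite u0 (le_trans _ uvr)// lerDl.
have vr : 0 <= v <= r by rewrite v0 (le_trans _ uvr)// lerDr.
have uvr' : 0 <= u + v <= r by rewrite addr_ge0.
apply: (csn_separates cK hausX) => p hp; apply/ler_addgt0Pr => e e0; rewrite add0r.
have [q hq hb] := exp_sum_bound r_gt0 hA hp.
have e40 : 0 < e / 4 by rewrite divr_gt0.
have [q1 hq1 h1] := exp_sumD hp.
have [M hM] : exists2 M, 0 < M & q1 x * M <= e / 4.
  exists (e / 4 / (q1 x + 1)); first by rewrite divr_gt0// ltr_wpDl ?(csn_ge0 hq1).
  rewrite mulrC mulrAC ler_pdivrMr ?ltr_wpDl ?(csn_ge0 hq1)//.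
  by rewrite ler_wpM2l ?(ltW e40)// lerDl.
move=> q1M.
have /(cvg_seminormP cK)/(_ _ hp _ e40)[N1 _ c1] := @hE _ uvr' x.
have /(cvg_seminormP cK)/(_ _ hq _ e40)[N2 _ c2] := @hE _ vr x.
have /(cvg_seminormP cK)/(_ _ hp _ e40)[N3 _ c3] := @hE _ ur (E v x).
have [N4 _ c4] := h1 _ hM.
pose N := maxn (maxn N1 N2) (maxn N3 N4).
have [l1 l2 l3 l4] : [/\ (N1 <= N)%N, (N2 <= N)%N, (N3 <= N)%N & (N4 <= N)%N].
  by rewrite /N !leq_max !leqnn !orbT.
(* The two sides are compared through S_2N(u + v), S_N(u) S_N(v) and
   S_N(u) E(v), where S_n denotes the n-th partial sum. *)
rewrite (_ : e = e / 4 + (e / 4 + (e / 4 + e / 4))); last first.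
  rewrite -!mulrDl -{1}(@mulfK _ 4 _ e)// ?pnatr_eq0//; congr (_ / _).
  by rewrite !addrA -!mulr2n -mulrSr -mulrSr mulr_natr.
apply: le_trans (csn_triangle hp (exp_sum A (u + v) (N + N) x) _ _) _; apply: lerD.
  by rewrite -(csnN hp) opprB ltW// c1 //= (leq_trans l1)// leq_addr.
apply: le_trans (csn_triangle hp (exp_sum A u N (exp_sum A v N x)) _ _) _; apply: lerD.
  by apply: le_trans (c4 _ l4 u v x u0 v0 uvr) _; rewrite mulrC.
apply: le_trans (csn_triangle hp (exp_sum A u N (E v x)) _ _) _; apply: lerD.
  by rewrite -Lb_applyB; apply: le_trans (hb _ _ _ ur) _; rewrite ltW// c2.
by rewrite ltW// c3.
Qed.

Lemma exp_natmul t k : 0 <= t -> t *+ k <= r -> E (t *+ k) = E t ^+ k.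
Proof.
move=> t0; elim: k => [_|k IHk kr].
  by rewrite mulr0n expr0 (exp0 cK hausX r_gt0 hA hE).
rewrite mulrS expD ?mulrn_wge0 -?mulrS// exprS IHk//.
by rewrite (le_trans _ kr)// mulrS lerDr.
Qed.

End ExpSemigroupLaw.

(** * Extension to a semigroup *)

Section Semigroup.
Context {K : numFieldType} (cK : nneg_complete K) {X : tvsType K}.
Hypotheses (hausX : hausdorff_space X).
Variables (A : Lb X) (r : K) (r_gt0 : 0 < r).
Hypothesis hA : exp_majorized A r.
Variables (E : K -> Lb X).
Hypothesis hE : exp_limit A r E.

(** At t >= 0 the value has to be E(t / m)^m for every m so large that t / m <= r.
    Asking for all such m at once lets later proofs choose one m for several
    times. *)
Definition semigroup_extension (T : K -> Lb X) : Prop :=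
  forall t m, 0 <= t -> (0 < m)%N -> t / m%:R <= r -> T t = E (t / m%:R) ^+ m.

Lemma steps_exist t : exists m, 0 <= t -> (0 < m)%N /\ t / m%:R <= r.
Proof.
have [t0|] := boolP (0 <= t); last by exists 0%N.
have [m] := nneg_complete_archi cK (divr_ge0 t0 (ltW r_gt0)).
rewrite ltr_pdivrMr// => tm; exists m => _.
case: m tm => [|m]; first by rewrite mul0r => /(le_lt_trans t0); rewrite ltxx.
by move=> tm; split=> //; rewrite ler_pdivrMr ?ltr0n// mulrC ltW.
Qed.

(** Two admissible subdivisions m and n give the same value, since both agree
    with the subdivision m n by the functional equation on [0, r]. *)
Lemma semigroup_extension_exists : exists T, semigroup_extension T.
Proof.
have [m hm] := choice steps_exist; exists (fun t => E (t / (m t)%:R) ^+ m t).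
move=> t n t0 n0 tn; have [m0 tm] := hm t t0.
suff refine k l : (0 < k)%N -> (0 < l)%N -> t / k%:R <= r ->
    E (t / k%:R) ^+ k = E (t / (k * l)%:R) ^+ (k * l).
  by rewrite (refine _ n)// [RHS](refine _ (m t))// mulnC.
move=> k0 l0 tk; rewrite mulnC exprM.
have e : t / (l * k)%:R *+ l = t / k%:R.
  have ln0 : l%:R != 0 :> K by rewrite pnatr_eq0 -lt0n.
  by rewrite -mulr_natr natrM invfM [t * _]mulrA mulrAC divfK.
by rewrite -[E _ ^+ l](exp_natmul cK hausX r_gt0 hA hE) ?e// divr_ge0.
Qed.

Variable (T : K -> Lb X).
Hypothesis hT : semigroup_extension T.

Lemma semigroup_exp t : 0 <= t <= r -> T t = E t.
Proof.
by move=> /andP[t0 tr]; rewrite (hT (m := 1))// ?divr1// expr1.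
Qed.

Lemma semigroup0 : T 0 = 1.
Proof. by rewrite semigroup_exp ?lexx ?ltW// (exp0 cK hausX r_gt0 hA hE). Qed.

Lemma semigroupD t s : 0 <= t -> 0 <= s -> T (t + s) = T t * T s.
Proof.
move=> t0 s0; have ts0 : 0 <= t + s by exact: addr_ge0.
have [m /(_ ts0)[m0 tsm]] := steps_exist (t + s).
have m0' : 0 < m%:R :> K by rewrite ltr0n.
have tm : t / m%:R <= r by rewrite (le_trans _ tsm)// ler_pM2r ?invr_gt0// lerDl.
have sm : s / m%:R <= r by rewrite (le_trans _ tsm)// ler_pM2r ?invr_gt0// lerDr.
rewrite !(hT _ m0)// mulrDl.
have tm0 : 0 <= t / m%:R by rewrite divr_ge0.
have sm0 : 0 <= s / m%:R by rewrite divr_ge0.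
rewrite mulrDl in tsm.
rewrite (expD cK hausX r_gt0 hA hE)// exprMn_comm//.
by rewrite /GRing.comm -!(expD cK hausX r_gt0 hA hE)// addrC.
Qed.

Lemma semigroup_bound p m : continuous_seminorm p -> (0 < m)%N ->
  exists2 q, continuous_seminorm q &
    forall t x, 0 <= t -> t / m%:R <= r -> p (T t x) <= q x.
Proof.
move=> hp m0.
suff [q hq h] : exists2 q, continuous_seminorm q &
    forall h x, 0 <= h <= r -> p ((E h ^+ m) x) <= q x.
  exists q => // t x t0 tm; rewrite (hT t0 m0 tm); apply: h.
  by rewrite tm divr_ge0.
elim: m {m0} p hp => [|m IHm] p hp; first by exists p => // h x _; rewrite expr0.
have [q hq hpq] := exp_bound cK r_gt0 hA hE hp.
have [q' hq' hqq] := IHm _ hq; exists q' => // h x hr.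
by rewrite exprS; apply: le_trans (hpq _ _ hr) (hqq _ _ hr).
Qed.

(** By the semigroup law T(t) - T(s) = T(s) (T(t - s) - 1) for s <= t.  The first
    factor is equicontinuous on bounded intervals, the second is of order t - s. *)
Lemma semigroup_lipschitz p m : continuous_seminorm p -> (0 < m)%N ->
  exists2 q, continuous_seminorm q &
    forall t s x, 0 <= t -> 0 <= s -> t / m%:R <= r -> s / m%:R <= r -> `|t - s| <= r ->
      p (T t x - T s x) <= `|t - s| * q x.
Proof.
move=> hp m0; have [q hq hpq] := semigroup_bound hp m0.
have [q' hq' h] := exp_remainder1 cK r_gt0 hA hE hq; exists q' => // .
have main t s x : 0 <= s -> s <= t -> s / m%:R <= r -> t - s <= r ->
    p (T t x - T s x) <= (t - s) * q' x.
  move=> s0 st sm tsr; have ts0 : 0 <= t - s by rewrite subr_ge0.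
  have tsr' : 0 <= t - s <= r by rewrite ts0.
  have -> : T t x - T s x = T s (T (t - s) x - x).
    rewrite Lb_applyB -[T s (T _ x)]/((T s * T (t - s)) x).
    by rewrite -semigroupD// [s + _]addrC subrK.
  by apply: le_trans (hpq _ _ s0 sm) _; rewrite (semigroup_exp tsr'); exact: h.
move=> t s x t0 s0 tm sm tsr.
have [ts|/ltW st] := real_leP (ger0_real t0) (ger0_real s0).
  rewrite -(csnN hp) opprB.
  by apply: main => //; rewrite -[X in X <= _]ger0_norm ?subr_ge0// distrC.
apply: main => //.
by rewrite -[X in X <= _]ger0_norm ?subr_ge0.
Qed.

Lemma near_small (t0 c d : K) : 0 <= c -> 0 < d ->
  \forall t \near t0, `|t - t0| <= r /\ `|t - t0| * c <= d.
Proof.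
move=> c0 d0; have near_lt (b : K) : 0 < b -> \forall t \near t0, `|t0 - t| < b.
  by move=> b0; apply/nbhs_ballP; exists b.
have dc0 : 0 < d / (c + 1) by rewrite divr_gt0// ltr_wpDl.
near=> t; split; first by rewrite distrC ltW//; near: t; exact: near_lt.
apply: (@le_trans _ _ (d / (c + 1) * c)).
  by rewrite ler_wpM2r// distrC ltW//; near: t; exact: near_lt.
by rewrite mulrAC ler_pdivrMr ?ltr_wpDl// ler_wpM2l ?(ltW d0)// lerDl.
Unshelve. all: by end_near. Qed.

Lemma semigroup_strongly_continuous x (t0 : K) : 0 <= t0 ->
  T t x @[t --> within [set t : K | 0 <= t] (nbhs t0)] --> T t0 x.
Proof.
move=> t00; apply/(cvg_seminormP cK) => p hp e e0.
have tr0 : 0 <= t0 + r by rewrite addr_ge0// ltW.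
have [m /(_ tr0)[m0 trm]] := steps_exist (t0 + r).
have [q hq h] := semigroup_lipschitz hp m0.
have m0' : 0 < m%:R :> K by rewrite ltr0n.
have e20 : 0 < e / 2 by rewrite divr_gt0.
rewrite /prop_near1 /within/=.
have := near_small t0 (csn_ge0 hq x) e20; apply: filterS => t [tr te] t_ge0.
have lem y : y <= t0 + r -> y / m%:R <= r.
  by move=> yt; rewrite (le_trans _ trm)// ler_pM2r ?invr_gt0.
apply: le_lt_trans (h t t0 x t_ge0 t00 _ _ tr) _; first last.
- by apply: le_lt_trans te _; rewrite ltr_pdivrMr// ltr_pMr// ltr1n.
- by apply: lem; rewrite lerDl ltW.
- apply: lem; rewrite -lerBlDl (le_trans _ tr)// real_ler_norm//.
  by rewrite realB ?ger0_real.
Qed.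

Lemma semigroup_norm_continuous : {within `[0, r], continuous T}.
Proof.
apply/subspace_continuousP => t0; rewrite /= in_itv /= => /andP[t00 t0r].
apply: (cvg_Lb cK) => p hp; have [q hq h] := semigroup_lipschitz hp (ltn0Sn 0).
exists q => // e e0; rewrite /prop_near1 /within/=.
have := near_small t0 ler01 e0; apply: filterS => t [tr te].
rewrite in_itv /= => /andP[t_ge0 t_le] x.
apply: le_trans (h t t0 x t_ge0 t00 _ _ tr) _; rewrite ?divr1//.
by rewrite ler_wpM2r ?(csn_ge0 hq)// -[`|_|]mulr1.
Qed.

Lemma exp_series_cvg t : 0 <= t <= r ->
  series (fun n => (t ^+ n / n`!%:R) *: A ^+ n) @ \oo --> T t.
Proof.
move=> tr; rewrite (semigroup_exp tr); apply: (cvg_Lb cK) => p hp.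
have [q hq h] := exp_series_unif cK r_gt0 hA hE hp; exists q => // e e0.
have := h _ e0; apply: filterS => n hn x; rewrite -(csnN hp) opprB.
exact: hn.
Qed.

(** The first order remainder is of order t^2, so every x lies in the domain of
    the generator, with value A x; limits are unique. *)
Lemma semigroup_generates : generates A T.
Proof.
suff gA x : generator T x (A x).
  move=> x y; split=> [gy|->//].
  exact: (cvg_unique hausX gy (gA x)).
apply/(cvg_seminormP cK) => p hp e e0.
have [q hq h] := exp_remainder2 cK r_gt0 hA hE hp.
have e20 : 0 < e / 2 by rewrite divr_gt0.
rewrite /prop_near1 /at_right /within /=.
have := near_small 0 (csn_ge0 hq x) e20; apply: filterS => t.
rewrite subr0 => -[tr te] t0.
rewrite gtr0_norm// in tr te.
have tr' : 0 <= t <= r by rewrite ltW.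
have -> : t^-1 *: (T t x - x) - A x = t^-1 *: (E t x - x - t *: A x).
  by rewrite (semigroup_exp tr') [RHS]scalerBr scalerA mulVf ?gt_eqF// scale1r.
rewrite (csnZ hp) gtr0_norm ?invr_gt0// mulrC ltr_pdivrMr//.
apply: le_lt_trans (h _ _ tr') _; rewrite expr2 -mulrA mulrC ltr_pM2r//.
by apply: le_lt_trans te _; rewrite ltr_pdivrMr// ltr_pMr// ltr1n.
Qed.

End Semigroup.

Theorem theorem3 (R : realType) (K : numFieldType)
    (hK : K = R :> numFieldType \/ K = R[i] :> numFieldType)
    (X : tvsType K) (hausX : hausdorff_space X) (scX : sequentially_complete X)
    (A : Lb X) (r : K) (r_gt0 : 0 < r)
    (hA : forall p : X -> K, continuous_seminorm p ->
      exists (q : X -> K) (mu : nat -> K),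
        [/\ continuous_seminorm q,
            forall n, 0 < mu n,
            forall n x, p ((A ^+ n) x) <= mu n * q x
          & cvgn (series (fun n => mu n / n`!%:R * r ^+ n))]) :
  exists T : K -> Lb X,
    [/\ C0_semigroup T,
        generates A T,
        {within `[0, r], continuous T}
      & forall t, 0 <= t <= r ->
          series (fun n => (t ^+ n / n`!%:R) *: A ^+ n) @ \oo --> T t].
Proof.
have cK : nneg_complete K.
  by case: hK => ->; [exact: nneg_complete_real|exact: nneg_complete_complex].
have hA' : exp_majorized A r.
  move=> p /hA[q [mu [hq mu0 pmu cmu]]].
  exists q, (fun n => mu n / n`!%:R * r ^+ n); split=> //; split=> // [n|n x].
    by rewrite mulr_ge0 ?divr_ge0 ?exprn_ge0// ltW.
  have -> : mu n / n`!%:R * r ^+ n * q x = r ^+ n / n`!%:R * (mu n * q x).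
    by rewrite -mulrA [mu n / _]mulrC mulrACA [_^-1 * _]mulrC.
  by rewrite ler_wpM2l// divr_ge0// exprn_ge0// ltW.
have [E hE] := exp_exists cK hausX scX r_gt0 hA'.
have [T hT] := semigroup_extension_exists cK hausX r_gt0 hA' hE.
exists T; split.
- split.
  + exact: (semigroup0 cK hausX r_gt0 hA' hE hT).
  + exact: (semigroupD cK hausX r_gt0 hA' hE hT).
  + by move=> x t0; exact: (semigroup_strongly_continuous cK hausX r_gt0 hA' hE hT).
- exact: (semigroup_generates cK hausX r_gt0 hA' hE hT).
- exact: (semigroup_norm_continuous cK hausX r_gt0 hA' hE hT).
- by move=> t; exact: (exp_series_cvg cK r_gt0 hA' hE hT).
Qed.
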